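(* Let $1\le k\le n$ and let $\mathcal S\subset\mathcal P_n$ be the stabilizer group of a stabilizer code with logical Pauli group $\mathcal L$. Let $p\in[0,1)$, $z=p/(3-3p)$, $p_{\rm QED}\in[0,1]$, and write $W(A)=W(A;z)$. For the QED-only protocol described in the context, put $$Q_{\rm QED}=(1-p_{\rm QED})W(N)+2^{k-n}p_{\rm QED}W(\tilde{\mathcal P}_n).$$ Then the infidelity conditioned on acceptance and the acceptance probability are $$1-F_{\rm QED}=Q_{\rm QED}^{-1}\Bigl[\bigl(1-p_{\rm QED}(1-2^{k-n})\bigr)W(N\setminus T)+(1-4^{-k})2^{k-n}p_{\rm QED}W(\tilde{\mathcal P}_n\setminus N)\Bigr],\qquad P_{A,{\rm QED}}=\frac{Q_{\rm QED}}{W(\tilde{\mathcal P}_n)}.$$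
   Context: Paulis. $\mathcal P_n$ is the $n$-qubit Pauli group (with phases $\pm1,\pm i$), $\tilde{\mathcal P}_n=\mathcal P_n/\langle iI\rangle$, and $\pi:\mathcal P_n\to\tilde{\mathcal P}_n$ is the projection. Elements of $\tilde{\mathcal P}_n$ are represented by strings in $\{I,X,Y,Z\}^n$; $\mathrm{wt}(E')$ is the number of non-identity letters. Two elements of $\tilde{\mathcal P}_n$ are said to commute (anticommute) if their representatives in $\mathcal P_n$ do. Code. $\mathcal S\subset\mathcal P_n$ is a subgroup with $2^{n-k}$ elements not containing $-I$. $C(\mathcal S)$ is its centralizer in $\mathcal P_n$. $\mathcal L\subseteq C(\mathcal S)$ is a subgroup with $C(\mathcal S)=\mathcal S\mathcal L$ and $\pi(\mathcal S)\cap\pi(\mathcal L)=\{\pi(I)\}$. $\mathcal S^*$ is the $\mathbb F_2$-dual of $\mathcal S$ (it has $2^{n-k}$ elements); the syndrome $\mathrm{syn}(E')\in\mathcal S^*$ is given by $\mathrm{syn}(E')(s)=1$ iff $E'$ anticommutes with $s$. $T=\pi(\mathcal S)$ and $N=\pi(\mathcal S\mathcal L)=\pi(C(\mathcal S))$ (zero-syndrome errors). For $A\subset\tilde{\mathcal P}_n$, $W(A;z)=\sum_{E'\in A}z^{\mathrm{wt}(E')}$. QED-only protocol. A random error $E'\in\tilde{\mathcal P}_n$ occurs with probability $(1-p)^{n-\mathrm{wt}(E')}(p/3)^{\mathrm{wt}(E')}$. Independently, with probability $1-p_{\rm QED}$ the reported syndrome is the true one $\mathrm{syn}(E')$, and with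 probability $p_{\rm QED}$ it is uniformly random in $\mathcal S^*$. The run is accepted iff the reported syndrome is $0$. On an accepted run the induced logical Pauli class in $N/T$ is the class of $E'$ if $E'\in N$, and is uniformly random among the $4^k$ classes if $E'\notin N$. $P_{A,{\rm QED}}$ is the probability of acceptance and $F_{\rm QED}$ is the conditional probability, given acceptance, that the logical class is trivial. *)

(* Defs.v *)
From HB Require Import structures.
From mathcomp Require Import all_boot all_order all_algebra all_fingroup all_solvable.

Set Implicit Arguments.
Unset Strict Implicit.
Unset Printing Implicit Defensive.

Import Order.TTheory GRing.Theory Num.Theory GroupScope.
Local Open Scope ring_scope.

Inductive letter := PI | PX | PY | PZ.

Definition bits_of_letter (a : letter) : bool * bool :=
  match a with
  | PI => (false, false) | PX => (true, false)
  | PY => (true, true)   | PZ => (false, true)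
  end.

Definition letter_of_bits (b : bool * bool) : letter :=
  match b with
  | (false, false) => PI | (true, false) => PX
  | (true, true) => PY   | (false, true) => PZ
  end.

Lemma bits_of_letterK : cancel bits_of_letter letter_of_bits.
Proof. by case. Qed.

HB.instance Definition _ := Equality.copy letter (can_type bits_of_letterK).
HB.instance Definition _ := Choice.copy letter (can_type bits_of_letterK).
HB.instance Definition _ := Countable.copy letter (can_type bits_of_letterK).
HB.instance Definition _ := Finite.copy letter (can_type bits_of_letterK).

Definition lmul (a b : letter) : letter :=
  match a, b with
  | PI, c | c, PI => c
  | PX, PX | PY, PY | PZ, PZ => PI
  | PX, PY | PY, PX => PZ
  | PY, PZ | PZ, PY => PX
  | PZ, PX | PX, PZ => PY
  end.

(* The exponent c with a b = i^c (lmul a b) as 2 x 2 matrices: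
   XY = iZ, YZ = iX, ZX = iY and the reversed products carry -i = i^3. *)
Definition lphase (a b : letter) : 'Z_4 :=
  match a, b with
  | PX, PY | PY, PZ | PZ, PX => 1
  | PY, PX | PZ, PY | PX, PZ => 3%:R
  | _, _ => 0
  end.

Lemma lmulA : associative lmul. Proof. by do 3!case. Qed.
Lemma lmul1 : left_id PI lmul. Proof. by case. Qed.
Lemma lmulV : left_inverse PI id lmul. Proof. by case. Qed.

HB.instance Definition _ := Finite_isGroup.Build letter lmulA lmul1 lmulV.

Lemma lphaseA (a b c : letter) :
  lphase a b + lphase (a * b)%g c = lphase b c + lphase a (b * c)%g.
Proof. by apply/eqP; case: a; case: b; case: c. Qed.

(* The quotient of the Pauli group by its phases <iI>: the type carries the
   pointwise (direct power) group law of the library. *)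
Notation pauli_string n := {dffun forall _ : 'I_n, letter}.

Definition wt n (E : pauli_string n) : nat := #|[set i | E i != PI]|.

(* [Pauli c E] is the operator i^c E_0 (x) ... (x) E_(n-1); see [pauli_opM]. *)
Record pauli (n : nat) := Pauli { phase : 'Z_4; letters : pauli_string n }.

Section PauliGroup.
Variable n : nat.
Implicit Types g h : pauli n.

Definition pair_of_pauli g := (phase g, letters g).
Definition pauli_of_pair (u : 'Z_4 * pauli_string n) := Pauli u.1 u.2.

Lemma pair_of_pauliK : cancel pair_of_pauli pauli_of_pair.
Proof. by case. Qed.

HB.instance Definition _ := Equality.copy (pauli n) (can_type pair_of_pauliK).
HB.instance Definition _ := Choice.copy (pauli n) (can_type pair_of_pauliK).
HB.instance Definition _ := Countable.copy (pauli n) (can_type pair_of_pauliK).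
HB.instance Definition _ := Finite.copy (pauli n) (can_type pair_of_pauliK).

Definition pmul g h : pauli n :=
  Pauli (phase g + phase h + \sum_(i < n) lphase (letters g i) (letters h i))
        (letters g * letters h)%g.

Definition pone : pauli n := Pauli 0 1%g.

(* Every Pauli string is its own inverse. *)
Definition pinv g : pauli n := Pauli (- phase g) (letters g).

Lemma pmulA : associative pmul.
Proof.
move=> [a x] [b y] [c z]; rewrite /pmul /= mulgA; congr Pauli.
have sumA : \sum_(i < n) lphase (y i) (z i)
            + \sum_(i < n) lphase (x i) ((y * z)%g i)
          = \sum_(i < n) lphase (x i) (y i)
            + \sum_(i < n) lphase ((x * y)%g i) (z i).
  by rewrite -!big_split; apply: eq_bigr => i _; rewrite !ffunE /= -lphaseA.
rewrite -!addrA; congr (_ + (_ + _)).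
by rewrite sumA addrCA.
Qed.

Lemma pmul1 : left_id pone pmul.
Proof.
case=> a x; rewrite /pmul /= mul1g !add0r big1 ?addr0 // => i _.
by rewrite ffunE; case: (x i).
Qed.

Lemma pmulV : left_inverse pone pinv pmul.
Proof.
case=> a x; rewrite /pmul /pone /= addNr add0r; congr Pauli.
  by rewrite big1 // => i _; case: (x i).
by apply/ffunP => i; rewrite !ffunE; case: (x i).
Qed.

HB.instance Definition _ := Finite_isGroup.Build (pauli n) pmulA pmul1 pmulV.

Definition pauli_iI : pauli n := Pauli 1 1%g.
Definition pauli_negI : pauli n := Pauli 2%:R 1%g.

Definition pauli_pi g : pauli_string n := letters g.

Lemma pauli_piM : {in setT &, {morph pauli_pi : g h / (g * h)%g}}.
Proof. by []. Qed.

Canonical pauli_pi_morphism := Morphism pauli_piM.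

Definition pauli_rep (E : pauli_string n) : pauli n := Pauli 0 E.

Lemma pauli_repK : cancel pauli_rep pauli_pi.
Proof. by []. Qed.

Lemma ker_pauli_pi : 'ker pauli_pi = <[pauli_iI]>%g.
Proof.
have iX m : (pauli_iI ^+ m)%g = Pauli m%:R 1%g.
  elim: m => [|m IH] //; rewrite expgS IH /mulg /= /pmul /= mulg1 -mulrS.
  by rewrite big1 ?addr0 // => i _; rewrite ffunE.
apply/setP=> g; apply/(kerP _ (in_setT g))/cycleP => [|[m ->]].
  by case: g => c x; rewrite /pauli_pi /= => ->; exists c; rewrite iX natr_Zp.
by rewrite iX.
Qed.

End PauliGroup.

Section PauliMatrices.
Variable C : numClosedFieldType.

Definition letter_mx (a : letter) (r s : bool) : C :=
  match a with
  | PI => (r == s)%:R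
  | PX => (r != s)%:R
  | PY => if r == s then 0 else if s then - 'i else 'i
  | PZ => if r == s then (-1) ^+ r else 0
  end.

(* Entry (u, v) of the operator denoted by g; rows and columns of the
   2^n x 2^n matrix are indexed by computational basis states. *)
Definition pauli_op n (g : pauli n) (u v : {ffun 'I_n -> bool}) : C :=
  'i ^+ (phase g) * \prod_(i < n) letter_mx (letters g i) (u i) (v i).

Let expZ4 (c : nat) : 'i ^+ (c %% 4) = 'i ^+ c :> C.
Proof. by rewrite expr_mod // (exprM _ 2 2) sqrCi sqrrN expr1n. Qed.

Let expiD (c d : 'Z_4) : 'i ^+ (c + d)%R = 'i ^+ c * 'i ^+ d :> C.
Proof. by rewrite -exprD /= expZ4. Qed.

Lemma letter_mxM (a b : letter) (r t : bool) :
  \sum_(s : bool) letter_mx a r s * letter_mx b s t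
  = 'i ^+ (lphase a b) * letter_mx (a * b)%g r t.
Proof.
have ii : 'i * 'i = -1 :> C by rewrite -expr2 sqrCi.
have i3 : 'i ^+ 3 = - 'i :> C by rewrite exprS sqrCi mulrN1.
rewrite big_bool; case: a; case: b; case: r; case: t;
  rewrite /= /mulg /= ?expr0 ?expr1 ?i3 ?(mul0r, mulr0, mul1r, mulr1, addr0,
    add0r, mulrN, mulNr, opprK, ii) //.
Qed.

Lemma pauli_opM n (g h : pauli n) (u w : {ffun 'I_n -> bool}) :
  \sum_v pauli_op g u v * pauli_op h v w = pauli_op (g * h)%g u w.
Proof.
have phaseM : phase (g * h)%g = phase g + phase h
    + \sum_(i < n) lphase (letters g i) (letters h i) by [].
have lettersM : letters (g * h)%g = (letters g * letters h)%g by [].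
rewrite /pauli_op phaseM lettersM !expiD.
have -> : 'i ^+ (\sum_(i < n) lphase (letters g i) (letters h i))%R
        = \prod_(i < n) 'i ^+ (lphase (letters g i) (letters h i)) :> C.
  by apply: (big_morph (fun c : 'Z_4 => 'i ^+ c : C) expiD); rewrite expr0.
rewrite -mulrA -big_split /=.
under [in RHS]eq_bigr => i _ do rewrite ffunE -letter_mxM.
rewrite bigA_distr_bigA mulr_sumr; apply: eq_bigr => v _.
by rewrite mulrACA -big_split.
Qed.

End PauliMatrices.

Section Syndrome.
Variable n : nat.

Definition anticommute (g h : pauli n) : bool :=
  (g * h == pauli_negI n * (h * g))%g.

Variable S : {group pauli n}.

Notation dual_fun := {ffun subg_of S -> 'F_2}.

Definition dual : {set dual_fun} :=
  [set f : dual_fun | [forall s, forall t, f (s * t)%g == f s + f t]].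

Definition syn (E : pauli_string n) : dual_fun :=
  [ffun s => (anticommute (pauli_rep E) (sgval s))%:R].

End Syndrome.

Definition wenum (R : realFieldType) n (A : {set pauli_string n}) (z : R) : R :=
  \sum_(E in A) z ^+ wt E.

Section FiniteProbability.
Variables (R : realFieldType) (X : finType).

Definition uniform (A : {set X}) (x : X) : R :=
  if x \in A then #|A|%:R^-1 else 0.

Definition Pr (mu : X -> R) (A : {set X}) : R := \sum_(x in A) mu x.

Definition cond_Pr (mu : X -> R) (B A : {set X}) : R :=
  Pr mu (A :&: B) / Pr mu A.

End FiniteProbability.

Section Protocol.
Variables (R : realFieldType) (n : nat) (p pQED : R).
Variables (S L : {group pauli n}).

(* T = pi(S) and N = pi(S L); N / T is the group of logical Pauli classes. *)
Definition trivial_errors : {group pauli_string n} := (@pauli_pi n @* S)%G.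

Definition undetected_errors : {set pauli_string n} := @pauli_pi n @* (S * L)%g.

Local Notation T := trivial_errors.
Local Notation N := undetected_errors.

Definition error_prob (E : pauli_string n) : R :=
  (1 - p) ^+ (n - wt E) * (p / 3%:R) ^+ wt E.

(* Conditional law of the reported syndrome given the error: a mixture of the
   true syndrome and of the uniform law on the dual of S. *)
Definition report_prob (E : pauli_string n)
    (sigma : {ffun subg_of S -> 'F_2}) : R :=
  (1 - pQED) * (sigma == syn S E)%:R + pQED * uniform R (dual S) sigma.

(* Conditional law of the logical Pauli class given the error. The protocol
   fixes it on accepted runs only; the same law is put on rejected runs, where
   it affects neither PA_QED nor F_QED. *)
Definition class_prob (E : pauli_string n) (c : coset_of T) : R :=
  if E \in N then (c == coset T E)%:R else uniform R (N / T)%g c.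

(* A run: the error, the reported syndrome and the logical class. *)
Definition run : finType :=
  (pauli_string n * {ffun subg_of S -> 'F_2} * coset_of T)%type.

Definition run_prob (w : run) : R :=
  let: (E, sigma, c) := w in
  error_prob E * report_prob E sigma * class_prob E c.

Definition accepted : {set run} := [set w : run | w.1.2 == 0].

Definition logically_trivial : {set run} := [set w : run | w.2 == 1%g].

Definition PA_QED : R := Pr run_prob accepted.

Definition F_QED : R := cond_Pr run_prob logically_trivial accepted.

End Protocol.

(* Main.v *)
(* Write T = pi(S), N = pi(C(S)). Commutation of Pauli strings is a
   nondegenerate symplectic pairing over F_2, and a syndrome vanishes exactly on
   N. Double counting the signs of this pairing on strings x S gives
   |S| |N| = 4^n; doing the same for the evaluation pairing on S^* x S gives
   |S^*| = |S|. Hence the false report 0 has probability 2^(k-n) and there are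
   |N / T| = 4^k classes. Since the error probabilities are
   (1-p)^n z^wt and sum to 1, (1-p)^n = 1 / W(all strings), and summing the
   joint law over accepted runs, respectively over accepted runs with trivial
   class, expresses both quantities through W. *)
Require Import Defs.
From mathcomp Require Import all_boot all_order all_algebra all_fingroup all_solvable.
From mathcomp Require Import ring lra zify.

Set Implicit Arguments.
Unset Strict Implicit.
Unset Printing Implicit Defensive.

Import Order.TTheory GRing.Theory Num.Theory GroupScope.
Local Open Scope ring_scope.

(** * Double counting of signs for a bilinear Boolean pairing *)

(** If [f a] holds for some [a] in [A], translation by [a] permutes [A] and flips every sign, so the
    integer sum equals its own negative. No group structure is asked of [op], so that both products
    and sums of functionals fit. *)
Lemma sum_sign (T : finType) (A : {set T}) (op : T -> T -> T) (f : T -> bool) :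
  (forall x, injective (op x)) -> {in A &, forall x y, op x y \in A} ->
  {in A &, forall x y, f (op x y) = f x (+) f y} ->
  \sum_(x in A) (-1) ^+ f x
    = if [forall x in A, ~~ f x] then #|A|%:R else 0 :> int.
Proof.
move=> op_inj opA fD; case: forall_inP => [f0 | /forall_inP].
  by rewrite -sumr_const; apply: eq_bigr => x /f0/negbTE->.
rewrite negb_forall_in => /exists_inP[a Aa]; rewrite negbK => fa.
(* An injection of the finite set [A] into itself is onto, so translation also reflects
   membership. *)
have opAE x : (op a x \in A) = (x \in A).
  apply/idP/idP => [|/(opA a x Aa) //].
  have /subset_leqif_cards[_]: op a @: A \subset A.
    by apply/subsetP=> _ /imsetP[y /(opA a y Aa) Ay ->].
  by rewrite card_imset // eqxx => /esym/eqP eqA; rewrite -{1}eqA mem_imset.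
have : \sum_(x in A) (-1) ^+ f x = - \sum_(x in A) (-1) ^+ f x :> int.
  rewrite {1}(reindex_inj (op_inj a)) -sumrN.
  apply: eq_big => x; rewrite opAE // => Ax.
  by rewrite fD // fa addTb signrN.
lia.
Qed.

(* Both sides evaluate the sum of [(-1) ^ b x y] over [X] x [Y]. *)
Lemma card_pairing (T U : finType) (X : {set T}) (Y : {set U})
    (opX : T -> T -> T) (opY : U -> U -> U) (b : T -> U -> bool) :
  (forall x, injective (opX x)) -> (forall y, injective (opY y)) ->
  {in X &, forall x x', opX x x' \in X} ->
  {in Y &, forall y y', opY y y' \in Y} ->
  (forall y, y \in Y ->
    {in X &, forall x x', b (opX x x') y = b x y (+) b x' y}) ->
  (forall x, x \in X ->
    {in Y &, forall y y', b x (opY y y') = b x y (+) b x y'}) ->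
  (#|X| * #|[set y in Y | [forall x in X, ~~ b x y]]|
   = #|Y| * #|[set x in X | [forall y in Y, ~~ b x y]]|)%N.
Proof.
move=> injX injY XX YY bX bY; apply/eqP; rewrite -(eqr_nat int) !natrM.
have cardE (V : finType) (Z : {set V}) (P : pred V) (c : nat) :
    c%:R * #|[set v in Z | P v]|%:R
    = \sum_(v in Z) (if P v then c%:R else 0) :> int.
  rewrite mulr_natr -sumr_const -big_mkcondr.
  by apply: eq_bigl => v; rewrite inE.
rewrite !cardE.
under eq_bigr => y Yy do
  rewrite -(sum_sign injX XX (bX y Yy)).
rewrite exchange_big /=; apply/eqP/eq_bigr => x Xx.
by rewrite (sum_sign injY YY (bY x Xx)).
Qed.

(** * The symplectic commutation form on Pauli strings *)

(** When the two exponents differ they are 1 and 3, which is the sign -1. *)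
Definition lanticomm (a b : letter) : bool := lphase a b != lphase b a.

Definition string_anticomm n (x y : pauli_string n) : bool :=
  \big[addb/false]_(i < n) lanticomm (x i) (y i).

Lemma string_anticommC n (x y : pauli_string n) :
  string_anticomm x y = string_anticomm y x.
Proof. by apply: eq_bigr => i _; rewrite /lanticomm eq_sym. Qed.

Lemma string_anticommMl n (x y z : pauli_string n) :
  string_anticomm (x * y)%g z
  = string_anticomm x z (+) string_anticomm y z.
Proof.
rewrite /string_anticomm -big_split /=; apply: eq_bigr => i _.
by rewrite ffunE; case: (x i); case: (y i); case: (z i).
Qed.

Lemma string_anticommMr n (x y z : pauli_string n) :
  string_anticomm x (y * z)%g
  = string_anticomm x y (+) string_anticomm x z.
Proof. by rewrite !(string_anticommC x) string_anticommMl. Qed.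

Lemma string_anticomm_nondeg n (y : pauli_string n) :
  y != 1%g -> exists x, string_anticomm x y.
Proof.
move=> ny1; have [i yi] : exists i, y i != PI.
  apply/existsP; apply: contraNT ny1 => /existsPn y1.
  by apply/eqP/ffunP => i; rewrite ffunE; apply/eqP/negPn; exact: y1.
(* One non-identity position suffices: [PZ] anticommutes with [PX], and [PX] with both [PY] and
   [PZ]. *)
pose c := if y i == PX then PZ else PX.
exists [ffun j => if j == i then c else PI].
rewrite /string_anticomm (bigD1 i) //= big1 => [|j /negbTE nji]; rewrite ffunE.
  by rewrite eqxx addbF /c; case: (y i) yi.
by rewrite nji; case: (y j).
Qed.

Lemma pauli_stringC n (x y : pauli_string n) : (x * y = y * x)%g.
Proof. by apply/ffunP=> i; rewrite !ffunE; case: (x i); case: (y i). Qed.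

Lemma pauli_mulC n (g h : pauli n) :
  (g * h = if string_anticomm (letters g) (letters h)
           then pauli_negI n * (h * g) else h * g)%g.
Proof.
(* Each anticommuting position shifts the exponent by 2; since 2 + 2 = 0 in ['Z_4], only the parity
   of their number survives. *)
have phC (r : seq 'I_n) : \sum_(i <- r) lphase (letters g i) (letters h i)
   = (if \big[addb/false]_(i <- r) lanticomm (letters g i) (letters h i)
      then 2%:R else 0) + \sum_(i <- r) lphase (letters h i) (letters g i).
  elim: r => [|i r IH]; first by rewrite !big_nil addr0.
  rewrite !big_cons IH addrCA !addrA; congr (_ + _).
  by case: (\big[_/_]_(j <- r) _); case: (letters g i); case: (letters h i);
     apply/eqP.
have negM (f : pauli n) :
    (pauli_negI n * f)%g = Pauli (2%:R + phase f) (letters f).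
  rewrite {1}/mulg /= /pmul /= mul1g; congr Pauli.
  by rewrite big1 ?addr0 // => i _; rewrite ffunE; case: (letters f i).
rewrite negM.
have -> : (g * h)%g = Pauli (phase g + phase h
    + \sum_(i < n) lphase (letters g i) (letters h i))
    (letters g * letters h)%g by [].
have -> : (h * g)%g = Pauli (phase h + phase g
    + \sum_(i < n) lphase (letters h i) (letters g i))
    (letters h * letters g)%g by [].
rewrite phC pauli_stringC [phase g + _]addrC /string_anticomm; case: ifP => _ /=.
  by rewrite addrCA.
by rewrite add0r.
Qed.

Lemma anticommuteE n (g h : pauli n) :
  anticommute g h = string_anticomm (letters g) (letters h).
Proof.
rewrite /anticommute pauli_mulC; case: ifP => _; first by rewrite eqxx.
rewrite -{1}[(h * g)%g]mul1g (inj_eq (mulIg _)).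
by apply/eqP => /(congr1 (@phase n)) /eqP.
Qed.

Lemma commute_pauliE n (g h : pauli n) :
  (g * h == h * g)%g = ~~ string_anticomm (letters g) (letters h).
Proof.
rewrite pauli_mulC; case: ifP => _; last by rewrite eqxx.
rewrite -{2}[(h * g)%g]mul1g (inj_eq (mulIg _)).
by apply/negbTE/eqP => /(congr1 (@phase n)) /eqP.
Qed.

Lemma card_pauli_string n : #|[set: pauli_string n]| = (4 ^ n)%N.
Proof.
rewrite cardsT card_ffun card_ord; congr (_ ^ _)%N.
suff: bijective bits_of_letter.
  by move/bij_eq_card->; rewrite card_prod card_bool.
by exists letter_of_bits; [exact: bits_of_letterK | case=> [[] []]].
Qed.

(** * Cardinalities of T, N and the dual of S *)

(** A phase i or -i in S would square to -I, and the phase -1 is -I itself. This is what makes the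
    projection injective on S. *)
Lemma stab_letters1 n (S : {group pauli n}) (s : pauli n) :
  pauli_negI n \notin S -> s \in S -> letters s = 1%g -> s = 1%g.
Proof.
case: s => c x negS Sc /= x1; rewrite {x}x1 in Sc *.
have sqE : (Pauli c 1 * Pauli c 1)%g = Pauli (c + c) 1%g :> pauli n.
  rewrite {1}/mulg /= /pmul /= mulg1 big1 ?addr0 // => i _.
  by rewrite ffunE.
have sq2 : c + c != 2%:R.
  apply: contraNneq negS => c2.
  rewrite (_ : pauli_negI n = Pauli (c + c) 1%g); first by rewrite -sqE groupM.
  by rewrite c2.
have c2 : c != 2%:R.
  by apply: contraNneq negS => c2; rewrite -[pauli_negI n]/(Pauli _ _) -c2.
suff -> : c = 0 by [].
by apply/eqP; case: c c2 sq2 {Sc sqE} => [[|[|[|[|]]]]].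
Qed.

Lemma cent_lettersP n (S : {group pauli n}) (x : pauli_string n) :
  (x \in @pauli_pi n @* 'C(S))
  = [forall s in S, ~~ string_anticomm x (letters s)].
Proof.
apply/idP/forall_inP => [|xS].
  case/morphimP=> g _ /centP gS -> s /gS /eqP; by rewrite commute_pauliE.
(* Commutation ignores phases, so the representative of phase 0 is a valid preimage. *)
apply/morphimP; exists (pauli_rep x) => //; apply/centP => s /xS xs.
by apply/eqP; rewrite commute_pauliE.
Qed.

Lemma syn_eq0 n (S : {group pauli n}) (x : pauli_string n) :
  (0 == syn S x) = (x \in @pauli_pi n @* 'C(S)).
Proof.
rewrite cent_lettersP; apply/eqP/forall_inP => [syn0 s Ss | xS].
  have /ffunP/(_ (subg S s)) := syn0; rewrite !ffunE subgK // anticommuteE /=.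
  by case: string_anticomm => // /eqP.
apply/ffunP => s; rewrite !ffunE anticommuteE /=.
by rewrite (negbTE (xS _ (subgP s))).
Qed.

Lemma syn_dual n (S : {group pauli n}) (x : pauli_string n) :
  syn S x \in dual S.
Proof.
rewrite inE; apply/forallP => s; apply/forallP => t; rewrite !ffunE.
rewrite !anticommuteE /= string_anticommMr.
by case: string_anticomm; case: string_anticomm.
Qed.

Lemma card_pi_stab n (S : {group pauli n}) :
  pauli_negI n \notin S -> #|@pauli_pi n @* S| = #|S|.
Proof.
move=> negS; rewrite morphimEsub ?subsetT // card_in_imset // => s t Ss St st.
apply/eqP; rewrite eq_mulVg1; apply/eqP.
apply: (stab_letters1 negS); first by rewrite groupM ?groupV.
have -> : letters (s^-1 * t)%g = (letters s * letters t)%g by [].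
rewrite [letters s]st; apply/ffunP => i; rewrite !ffunE.
by case: (letters t i).
Qed.

(** Double counting for the commutation pairing between all strings and S: by nondegeneracy only 1
    in S pairs trivially with every string, while the strings pairing trivially with S form the
    projected centralizer. *)
Lemma card_pi_cent n (S : {group pauli n}) :
  pauli_negI n \notin S -> (#|S| * #|@pauli_pi n @* 'C(S)| = 4 ^ n)%N.
Proof.
move=> negS; have := @card_pairing _ _ [set: pauli_string n] S mulg mulg
  (fun x s => string_anticomm x (letters s)).
rewrite (_ : [set y in S | _] = 1%g); last first.
  apply/setP=> s; rewrite !inE; apply/andP/eqP => [[Ss /forall_inP s0]|->].
    apply: (stab_letters1 negS) => //; apply/eqP; apply: contraT.
    by case/string_anticomm_nondeg => x; rewrite (negbTE (s0 x _)) ?inE.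
  split=> //; apply/forall_inP => x _; rewrite /string_anticomm big1 // => i _.
  by rewrite ffunE; case: (x i).
rewrite (_ : [set x in _ | _] = @pauli_pi n @* 'C(S)); last first.
  by apply/setP=> x; rewrite !inE cent_lettersP.
rewrite cards1 muln1 card_pauli_string => <- //.
- exact: mulgI.
- exact: mulgI.
- by move=> *; apply: groupM.
- by move=> s _ x y _ _; rewrite string_anticommMl.
- by move=> x _ s t _ _; rewrite string_anticommMr.
Qed.

(** Double counting for the evaluation pairing. Only the zero functional vanishes on S, and the
    syndromes of strings already separate 1 from the other elements of S. *)
Lemma card_dual n (S : {group pauli n}) :
  pauli_negI n \notin S -> #|dual S| = #|S|.
Proof.
move=> negS.
have := @card_pairing {ffun subg_of S -> 'F_2} _ (dual S) [set: subg_of S]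
  +%R mulg (fun f s => f s != 0).
rewrite (_ : [set y in _ | _] = 1%g); last first.
  apply/setP=> s; rewrite !inE; apply/forall_inP/eqP => [s0|-> f].
    apply: val_inj; apply: (stab_letters1 negS (subgP s)).
    apply/eqP; apply: contraT => /string_anticomm_nondeg[x xs].
    have := s0 _ (syn_dual S x); rewrite ffunE anticommuteE /=.
    by rewrite xs.
  rewrite inE => /forallP/(_ 1%g)/forallP/(_ 1%g); rewrite mulg1.
  by rewrite -{1}[f _]addr0 (inj_eq (addrI _)) negbK eq_sym.
rewrite (_ : [set f : {ffun subg_of S -> 'F_2} in dual S |
                [forall s in [set: subg_of S], ~~ (f s != 0)]] 
              = [set (0 : {ffun subg_of S -> 'F_2})]); last first.
  apply/setP=> f; rewrite !inE; apply/andP/eqP => [[_ /forall_inP f0]|->].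
    by apply/ffunP=> s; rewrite ffunE; apply/eqP/negPn/f0; rewrite inE.
  split; first by do 2!apply/forallP => ?; rewrite !ffunE addr0.
  by apply/forall_inP => s _; rewrite ffunE negbK.
(* Being nonzero identifies ['F_2] with the Booleans, addition becoming exclusive or. *)
have F2D (a b : 'F_2) : (a + b != 0) = (a != 0) (+) (b != 0).
  by case: a b => [[|[|]]] // ? [[|[|]]].
rewrite !cards1 !muln1 -(card_isog (isog_subg S)) => -> //.
- exact: addrI.
- exact: mulgI.
- move=> f g /[!inE] /forallP fD /forallP gD; apply/forallP=> s.
  apply/forallP=> t.
  by rewrite !ffunE (eqP (forallP (fD s) t)) (eqP (forallP (gD s) t)) addrACA.
- by move=> s _ f g _ _; rewrite ffunE F2D.
- move=> f /[!inE] /forallP fD s t _ _.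
  by rewrite (eqP (forallP (fD s) t)) F2D.
Qed.

(** * Weight enumerators and error probabilities *)

Lemma wenum_setT (R : realFieldType) n (z : R) :
  wenum [set: pauli_string n] z = (1 + 3%:R * z) ^+ n.
Proof.
have sum_letter : \sum_(a : letter) z ^+ (a != PI) = 1 + 3%:R * z.
  rewrite (bigD1 PI) //= (bigD1 PX) //= (bigD1 PY) //= (bigD1 PZ) //=.
  by rewrite big1 => [|[]//]; rewrite expr0 !expr1; ring.
have -> : (1 + 3%:R * z) ^+ n = \prod_(i < n) (1 + 3%:R * z).
  by rewrite prodr_const card_ord.
(* Expanding the product of the one-letter sums yields one term per string. *)
rewrite -sum_letter bigA_distr_bigA /=.
apply: eq_big => [x|x _]; first by rewrite inE.
rewrite /wt -sum1_card -expr_sum; congr (z ^+ _).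
by rewrite -big_mkcond; apply: eq_bigl => i; rewrite inE.
Qed.

Lemma wt_leq n (x : pauli_string n) : (wt x <= n)%N.
Proof. by rewrite -[leqRHS](card_ord n) max_card. Qed.

Lemma sum_error_prob (R : realFieldType) n (p : R) (A : {set pauli_string n}) :
  p < 1 ->
  \sum_(x in A) error_prob p x
  = (1 - p) ^+ n * wenum A (p / (3%:R - 3%:R * p)).
Proof.
move=> p1; have q0 : 1 - p != 0 by rewrite subr_eq0 gt_eqF.
rewrite mulr_sumr; apply: eq_bigr => x _; rewrite /error_prob.
(* The choice of z makes p/3 = (1 - p) z, so the powers of 1 - p recombine to the exponent n; the
   truncated [n - wt x] is harmless by [wt_leq]. *)
have -> : p / 3%:R = (1 - p) * (p / (3%:R - 3%:R * p)).
  by field; rewrite (_ : _ - _ = 3%:R * (1 - p)) ?mulf_neq0 ?pnatr_eq0 //; ring.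
by rewrite exprMn mulrA -exprD subnK ?wt_leq.
Qed.

(** * The joint law of acceptance and logical class *)

(** A general [B] serves both probabilities: all classes for acceptance, the trivial class alone for
    the numerator of the fidelity. *)
Lemma Pr_accepted (R : realFieldType) n (p q : R) (S L : {group pauli n})
    (B : {set coset_of (trivial_errors S)}) :
  Pr (run_prob p q L) (accepted S :&: [set w : run S | w.2 \in B])
  = \sum_x error_prob p x * report_prob q x (0 : {ffun subg_of S -> 'F_2})
           * \sum_(c in B) class_prob R L x c.
Proof.
rewrite /Pr; under [RHS]eq_bigr => x _ do rewrite mulr_sumr.
rewrite pair_big_dep /=.
pose h (u : pauli_string n * coset_of (trivial_errors S)) : run S :=
  (u.1, 0 : {ffun subg_of S -> 'F_2}, u.2).
rewrite (reindex_onto h (fun w => (w.1.1, w.2))) /=; last first.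
  by case=> [[x s] c]; rewrite !inE /= => /andP[/eqP-> _].
by apply: eq_bigl => -[x c]; rewrite !inE /= !eqxx andbT.
Qed.

Lemma pauli_string_norm n (T : {group pauli_string n}) (x : pauli_string n) :
  x \in 'N(T).
Proof.
have abP : abelian [set: pauli_string n].
  by apply/centsP => y _ z _; apply: pauli_stringC.
by apply: (subsetP (sub_abelian_norm abP (subsetT T))); rewrite inE.
Qed.

Lemma trivial_sub_undetected n (S L : {group pauli n}) :
  trivial_errors S \subset undetected_errors S L.
Proof. by rewrite morphimS ?mulG_subl. Qed.

Lemma card_logical_classes n k (S L : {group pauli n}) :
  (k <= n)%N -> #|S| = (2 ^ (n - k))%N -> pauli_negI n \notin S ->
  'C(S) = (S * L)%g ->
  #|(undetected_errors S L / trivial_errors S)%g| = (4 ^ k)%N.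
Proof.
move=> kn cS negS CSL; have sTN := trivial_sub_undetected S L.
have cN := card_pi_cent negS; have cT := card_pi_stab negS.
rewrite /undetected_errors -CSL in sTN *.
rewrite card_quotient; last by apply/subsetP=> x _; exact: pauli_string_norm.
have := Lagrange sTN; rewrite /= cT cS => cNT; move: cN.
(* The factor 4^(n-k) is |S| |T|, which cancels and leaves the index of T in N. *)
have -> : (4 ^ n = 4 ^ (n - k) * 4 ^ k)%N by rewrite -expnD subnK.
rewrite cS -cNT mulnA -expnD addnn -mul2n expnM.
by move/eqP; rewrite eqn_pmul2l ?expn_gt0 // => /eqP.
Qed.

Lemma sum_class_prob (R : realFieldType) n (S L : {group pauli n})
    (x : pauli_string n) (B : {set coset_of (trivial_errors S)}) :
  \sum_(c in B) class_prob R L x c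
  = if x \in undetected_errors S L then (coset (trivial_errors S) x \in B)%:R
    else #|(undetected_errors S L / trivial_errors S)%g :&: B|%:R
         / #|(undetected_errors S L / trivial_errors S)%g|%:R.
Proof.
rewrite /class_prob; case: ifP => _.
  rewrite big_mkcond (bigD1 (coset _ x)) //= eqxx big1 ?addr0 => [|c /negbTE->].
    by case: ifP.
  by rewrite if_same.
rewrite /uniform mulr_natl -[RHS]sumr_const -big_mkcondr.
by apply: eq_bigl => c; rewrite inE andbC.
Qed.

Lemma report_prob0 (R : realFieldType) n (q : R) (S L : {group pauli n})
    (x : pauli_string n) :
  pauli_negI n \notin S -> 'C(S) = (S * L)%g ->
  report_prob q x (0 : {ffun subg_of S -> 'F_2})
  = (1 - q) * (x \in undetected_errors S L)%:R + q / #|S|%:R.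
Proof.
move=> negS CSL; rewrite /report_prob syn_eq0 /undetected_errors -CSL.
rewrite /uniform card_dual // ifT // inE.
by apply/forallP => s; apply/forallP => t; rewrite !ffunE addr0.
Qed.

(** An error in N is reported as 0 either truly or by chance, and its class is determined, so only
    the preimage [A] of [B] counts. Outside N the report 0 arises only by chance, and the uniform
    class falls in [B] with probability [b]. *)
Lemma Pr_accepted_wenum (R : realFieldType) n (p q b : R)
    (S L : {group pauli n}) (B : {set coset_of (trivial_errors S)})
    (A : {set pauli_string n}) :
  let N := undetected_errors S L in
  let z := p / (3%:R - 3%:R * p) in
  p < 1 -> pauli_negI n \notin S -> 'C(S) = (S * L)%g -> A \subset N ->
  {in N, forall x, (coset (trivial_errors S) x \in B) = (x \in A)} ->
  #|(N / trivial_errors S)%g :&: B|%:R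
    / #|(N / trivial_errors S)%g|%:R = b ->
  Pr (run_prob p q L) (accepted S :&: [set w : run S | w.2 \in B])
  = (1 - p) ^+ n * ((1 - q + q / #|S|%:R) * wenum A z
                    + q / #|S|%:R * b * wenum (~: N) z).
Proof.
move=> N z p1 negS CSL sAN BA bE.
rewrite Pr_accepted (bigID (mem N)) /= mulrDr; congr (_ + _).
  rewrite mulrCA -sum_error_prob // mulr_sumr.
  rewrite [RHS](eq_bigl (fun x => (x \in N) && (x \in A))); last first.
    by move=> x; rewrite andb_idl //; apply: (subsetP sAN).
  rewrite big_mkcondr; apply: eq_bigr => x Nx.
  rewrite sum_class_prob Nx BA // (report_prob0 _ _ negS CSL) Nx mulr1.
  by case: ifP; rewrite ?mulr1 ?mulr0 // mulrC.
rewrite mulrCA -sum_error_prob // mulr_sumr.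
apply: eq_big => [x|x NNx]; first by rewrite inE.
rewrite sum_class_prob (report_prob0 _ _ negS CSL) (negbTE NNx) bE.
by rewrite mulr0 add0r -mulrA mulrC.
Qed.

(** * Normalization, positivity of Q and the two formulas *)

Theorem corollary2 (R : realFieldType) (n k : nat) (S L : {group pauli n})
    (p pQED : R)
    (hk : (1 <= k <= n)%N)
    (hScard : #|S| = (2 ^ (n - k))%N)
    (hSneg : pauli_negI n \notin S)
    (hLC : L \subset 'C(S))
    (hCSL : 'C(S) = (S * L)%g)
    (hSL : (@pauli_pi n @* S) :&: (@pauli_pi n @* L) = [set @pauli_pi n 1%g])
    (hp : 0 <= p < 1)
    (hq : 0 <= pQED <= 1) :
  let z := p / (3%:R - 3%:R * p) in
  let W (A : {set pauli_string n}) := wenum A z in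
  let T : {set pauli_string n} := trivial_errors S in
  let N : {set pauli_string n} := undetected_errors S L in
  let P : {set pauli_string n} := [set: pauli_string n] in
  let e : R := 2%:R ^ (k%:Z - n%:Z) in
  let Q := (1 - pQED) * W N + e * pQED * W P in
  1 - F_QED p pQED S L
    = Q^-1 * ((1 - pQED * (1 - e)) * W (N :\: T)
              + (1 - 4%:R ^- k) * e * pQED * W (P :\: N))
  /\ PA_QED p pQED S L = Q / W P.
Proof.
move=> z W T N P e Q.
have [p0 p1] := andP hp; have [q0 q1] := andP hq; have [_ kn] := andP hk.
have z0 : 0 <= z by apply: divr_ge0 => //; lra.
have cNT := card_logical_classes kn hScard hSneg hCSL.
have sTN := trivial_sub_undetected S L.
have a0 : 1 - p != 0 by rewrite subr_eq0 gt_eqF.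
(* The error probabilities sum to 1, because (1 - p)(1 + 3z) = 1. *)
have aW : (1 - p) ^+ n * W P = 1.
  rewrite /W wenum_setT -exprMn (_ : (1 - p) * _ = 1) ?expr1n //.
  rewrite /z; field.
  by rewrite (_ : _ - _ = 3%:R * (1 - p)) ?mulf_neq0 ?pnatr_eq0 //; ring.
have eE : pQED / #|S|%:R = e * pQED.
  rewrite hScard natrX /e -opprB subzn // mulrC.
  by rewrite -exprnN.
(* The identity string contributes z^0 = 1, even when z = 0. *)
have W1 (A : {set pauli_string n}) : 1%g \in A -> 1 <= W A.
  move=> A1; rewrite /W /wenum (bigD1 1%g) //=.
  rewrite (_ : wt _ = 0%N) ?expr0 ?lerDl ?sumr_ge0 // => [x _|].
    by rewrite exprn_ge0.
  by apply: eq_card0 => i; rewrite !inE ffunE.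
have WD (A B : {set pauli_string n}) : B \subset A -> W A = W B + W (A :\: B).
  by move=> sBA; rewrite /W /wenum (big_setID B) /= (setIidPr sBA).
have WP := WD P N (subsetT N); have WN := WD N T sTN.
have N1 : 1%g \in N by rewrite (subsetP sTN) ?group1.
have e0 : 0 < e by rewrite exprz_gt0.
(* Q is at least (1 - pQED) + e pQED, whose first term vanishes only at pQED = 1, where the second
   is e > 0. *)
have Q0 : 0 < Q.
  have WN1 : 1 - pQED <= (1 - pQED) * W N.
    by rewrite ler_peMr ?subr_ge0 // W1.
  have WP1 : e * pQED <= e * pQED * W P.
    by rewrite ler_peMr ?W1 ?inE // mulr_ge0 // ltW.
  apply: lt_le_trans (lerD WN1 WP1).
  have [->|q_neq1] := eqVneq pQED 1; first by rewrite subrr add0r mulr1.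
  by rewrite ltr_pwDl ?subr_gt0 ?lt_neqAle ?q_neq1 // mulr_ge0 // ltW.
have PrA : Pr (run_prob p pQED L) (accepted S) = (1 - p) ^+ n * Q.
  rewrite -[accepted S]setIT.
  rewrite (_ : setT = [set w : run S | w.2 \in setT]); last first.
    by apply/setP=> w; rewrite !inE.
  (* With every class allowed, the preimage is all of N and [b] is 1. *)
  rewrite (@Pr_accepted_wenum _ _ _ _ 1 _ _ _ N) //; first last.
  - by rewrite setIT divff // cNT pnatr_eq0 expn_eq0.
  - by move=> x; rewrite inE => ->.
  rewrite eE mulr1 -/z -/(W _) -/(W _) -setTD -/P /Q WP; ring.
have PrT : Pr (run_prob p pQED L) (accepted S :&: logically_trivial S)
   = (1 - p) ^+ n * ((1 - pQED + e * pQED) * W T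
                     + e * pQED * 4%:R ^- k * W (P :\: N)).
  rewrite (_ : logically_trivial S
               = [set w : run S | w.2 \in [set 1%g]]); last first.
    by apply/setP=> w; rewrite !inE.
  (* The trivial class has preimage T in N and is one of 4^k equally likely classes. *)
  rewrite (@Pr_accepted_wenum _ _ _ _ (4%:R ^- k) _ _ _ T) ?eE ?setTD //.
  - move=> x _; rewrite inE; apply/eqP/idP => [|/coset_id //].
    by apply: coset_idr; exact: pauli_string_norm.
  - rewrite (setIidPr _) ?cards1 ?cNT ?natrX ?div1r // sub1set.
    by rewrite /undetected_errors -hCSL group1.
have WPn0 : W P != 0 by rewrite gt_eqF // (lt_le_trans ltr01) // W1 ?inE.
split; last first.
  apply: (mulIf WPn0).
  by rewrite /PA_QED PrA mulfVK // mulrAC aW mul1r.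
rewrite /F_QED /cond_Pr PrA PrT.
have an0 : (1 - p) ^+ n != 0 by rewrite expf_neq0.
have Qn0 : Q != 0 by rewrite gt_eqF.
(* The factor (1 - p)^n cancels; with 1 written as Q^-1 Q, what remains is an identity in the
   weights of T, N minus T and the complement of N. *)
rewrite -mulf_div divff // mul1r -[X in X - _](mulVf Qn0) [_ / Q]mulrC -mulrBr.
congr (_ * _); rewrite /Q WP WN; ring.
Qed.
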